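(* Let $(\alpha_n)_{n\ge 0}$ be a sequence of Verblunsky coefficients, $b\in(0,1)$, $p\ge1$ an integer, and $c_1,\dots,c_p\in\mathbb{C}$ such that $\prod_{j=1}^p c_j=1$ and $$\lim_{m\to\infty}\frac{\alpha_{mp+\ell}}{\alpha_{mp+\ell-1}}=b\,c_\ell,\qquad \ell=1,2,\dots,p$$ (in particular $\alpha_n\ne0$ for all large $n$). Extend $c_j$ to all $j\in\mathbb{Z}$ by $c_{j+p}=c_j$. For $\ell=1,\dots,p$ let $$W_\ell(z)=\sum_{k=0}^{p-1}\Bigl(\prod_{j=1}^{k}(b\,\overline{c_{\ell-j}})^{-1}\Bigr)z^k ,$$ and let $w_1^{(\ell)},\dots,w_{N_\ell}^{(\ell)}$ be the zeros of $W_\ell$ in $\{z : |z|<b\}$, listed with multiplicity. Then for any sufficiently small $\delta>0$ there is an $N$ such that whenever $mp+\ell\ge N$ (with $1\le \ell\le p$), the only zeros of $\varphi_{mp+\ell}$ in $\{z : |z|<b-\delta\}$ are one each within $\delta$ of each $w_j^{(\ell)}$ (meaning exactly $k$ zeros, counting multiplicity, within $\delta$ of a point occurring exactly $k$ times in the list).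
   Context: A sequence of Verblunsky coefficients is a sequence $(\alpha_n)_{n\ge0}$ in the open unit disk $\mathbb{D}$. The associated monic orthogonal polynomials on the unit circle are defined by $\Phi_0=1$ and $\Phi_{n+1}(z)=z\Phi_n(z)-\overline{\alpha_n}\,\Phi_n^*(z)$, where $\Phi_n^*(z)=z^n\,\overline{\Phi_n(1/\bar z)}$. The orthonormal polynomials are $\varphi_n=\Phi_n\big/\prod_{j=0}^{n-1}(1-|\alpha_j|^2)^{1/2}$. Empty products equal $1$. *)

(* Defs.v *)
From mathcomp Require Import all_boot all_order all_algebra.
From mathcomp Require Export complex.

Set Implicit Arguments.
Unset Strict Implicit.
Unset Printing Implicit Defensive.

Import Order.TTheory GRing.Theory Num.Theory.
Local Open Scope ring_scope.

Section Zeros.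
Variable F : closedFieldType.
Implicit Type p : {poly F}.

(* All zeros of p, listed with multiplicity (meaningless for p = 0). *)
Definition zeros p : seq F := sval (closed_field_poly_normal p).

Lemma zerosE p : p = lead_coef p *: \prod_(z <- zeros p) ('X - z%:P).
Proof. exact: svalP (closed_field_poly_normal p). Qed.

Lemma count_mem_zeros p z : p != 0 -> count_mem z (zeros p) = mup z p.
Proof.
move=> p0; rewrite [in RHS](zerosE p) -mul_polyC mupMr ?mu_prod_XsubC //.
by rewrite rootC lead_coef_eq0.
Qed.

End Zeros.

Section OPUC.
Variable C : numClosedFieldType.
Implicit Types (P : {poly C}) (alpha : nat -> C).

(* The polynomial z^n conj(P(1 / conj z)), for P of degree at most n; see
   horner_reversed. *)
Definition reversed n P : {poly C} := \poly_(i < n.+1) (P`_(n - i))^*.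

Lemma horner_reversed n P (z : C) : (size P <= n.+1)%N -> z != 0 ->
  (reversed n P).[z] = z ^+ n * (P.[(z^*)^-1])^*.
Proof.
move=> sP z0; rewrite horner_poly (horner_coef_wide _ sP) rmorph_sum mulr_sumr.
rewrite (reindex_inj rev_ord_inj) /=; apply: eq_bigr => i _.
have lin : (i <= n)%N by rewrite -ltnS.
rewrite subSS subKn // rmorphM rmorphXn /= fmorphV /= conjCK mulrCA.
by rewrite exprVn -[X in z ^+ X / _](subnK lin) exprD mulfK ?expf_neq0.
Qed.

Fixpoint Phi alpha n : {poly C} :=
  if n is m.+1
  then 'X * Phi alpha m - (alpha m)^* *: reversed m (Phi alpha m)
  else 1.

Lemma size_Phi alpha n : (size (Phi alpha n) <= n.+1)%N.
Proof.
elim: n => [|n IHn] /=; first by rewrite size_poly1.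
rewrite (leq_trans (size_polyD _ _)) // geq_max size_polyN.
rewrite (leq_trans (size_polyMleq _ _)) ?size_polyX //=.
by rewrite (leq_trans (size_scale_leq _ _)) ?(leq_trans (size_poly _ _)).
Qed.

Definition phi alpha n : {poly C} :=
  (\prod_(j < n) sqrtC (1 - `|alpha j| ^+ 2))^-1 *: Phi alpha n.

Definition W (p : nat) (b : C) (c : int -> C) (l : int) : {poly C} :=
  \poly_(k < p) \prod_(1 <= j < k.+1) (b * (c (l - j%:Z))^*)^-1.

End OPUC.

(* Main.v *)
(** The recursions for [Phi_n] and [Phi_n^*] give, for
    [F_n = - Phi_n / conj alpha_(n-1)],
      [F_(n+1) = Phi_n^* + z (conj alpha_(n-1) / conj alpha_n) F_n],
    while [W_(n+1) = 1 - z^p / b^p + z / (b conj c_n) W_n].  Hence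
    [E_n = (1 - z^p / b^p) F_(n+1) - W_(n+1) Phi_n^*] satisfies
    [E_(n+1) = z (beta_n E_n + small)] with [beta_n] close to
    [1 / (b conj c_(n+1))], small because [alpha_n] decays geometrically.  As the
    product of the [c_j] over a period is 1, weighting by
    [|c_1| ... |c_n|] turns this into a contraction of ratio about [|z| / b], so
    [E_n -> 0] uniformly on [|z| <= r < b].  The [Phi_n^*] are bounded away from 0
    on the closed unit disk, so the zeros of [Phi_n] in [|z| < b] approach those
    of [W_n] by Rouche's theorem, which is only needed for polynomials.

    Rouche's theorem is obtained without contour integrals: averaging
    [(z - w) P'(z) / P(z)] over the points [z] with [(z - w)^N = rho^N] gives exactly
    the sum of [1 / (1 - ((u - w) / rho)^N)] over the zeros [u] of [P].  Away from
    the circle this is within 1/4 of the number of zeros inside it for [N]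
    large, and it is Lipschitz along the segment from [Q] to [P]. *)
Require Import Defs.
From mathcomp Require Import all_boot all_order all_algebra.
From mathcomp Require Import all_classical all_reals all_analysis.
From mathcomp Require Import ring lra zify.
Import Order.TTheory GRing.Theory Num.Theory.
Import numFieldNormedType.Exports.
Import ComplexField.Normc.
Local Open Scope classical_set_scope.
Local Open Scope ring_scope.

Set Implicit Arguments.
Unset Strict Implicit.
Unset Printing Implicit Defensive.

(** * Real-valued modulus on [R[i]] *)

Section Modulus.
Variable R : rcfType.
Implicit Types z w : R[i].

Lemma normE z : `|z| = (normc z)%:C%C.
Proof. by rewrite normc_def; case: z. Qed.

Lemma normc_ge0 z : 0 <= normc z.
Proof. by case: z => x y /=; rewrite sqrtr_ge0. Qed.

Lemma normc_eq0 z : (normc z == 0) = (z == 0).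
Proof. by apply/eqP/eqP => [/eq0_normc|->]; rewrite ?normc0. Qed.

Lemma normc_gt0 z : (0 < normc z) = (z != 0).
Proof. by rewrite lt_def normc_ge0 andbT normc_eq0. Qed.

Lemma normc_real (x : R) : normc x%:C%C = `|x|.
Proof. by rewrite /= expr0n addr0 sqrtr_sqr. Qed.

Lemma normc_conj z : normc z^* = normc z.
Proof. by apply: complexI; rewrite -!normE norm_conjC. Qed.

Lemma normcX z n : normc (z ^+ n) = normc z ^+ n.
Proof. by elim: n => [|n IHn]; rewrite ?expr0 ?normc1 // !exprS normcM IHn. Qed.

Lemma normc_nat n : normc (n%:R : R[i]) = n%:R.
Proof. by rewrite -(rmorph_nat (real_complex R)) normc_real normr_nat. Qed.

Lemma distcC z w : normc (z - w) = normc (w - z).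
Proof. by rewrite -normcN opprB. Qed.

Lemma le_normcB z w : normc (z - w) <= normc z + normc w.
Proof. by rewrite (le_trans (le_normcD _ _)) // normcN. Qed.

Lemma lerB_normc z w : normc z - normc w <= normc (z - w).
Proof. by rewrite lerBlDr (le_trans _ (le_normcD _ _)) // subrK. Qed.

Lemma le_distcD v z w : normc (z - w) <= normc (z - v) + normc (v - w).
Proof. by rewrite (le_trans _ (le_normcD _ _)) // subrKA. Qed.

Lemma le_normc_sum (I : eqType) (s : seq I) (F : I -> R[i]) (G : I -> R) :
  (forall i, i \in s -> normc (F i) <= G i) ->
  normc (\sum_(i <- s) F i) <= \sum_(i <- s) G i.
Proof.
move=> FG; rewrite big_seq [leRHS]big_seq.
elim/big_ind2: _ => [|x1 x2 y1 y2 h1 h2|i /FG //]; first by rewrite normc0.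
by rewrite (le_trans (le_normcD _ _)) ?lerD.
Qed.

Lemma normc_prod (I : eqType) (s : seq I) (F : I -> R[i]) :
  normc (\prod_(i <- s) F i) = \prod_(i <- s) normc (F i).
Proof. by apply: (big_morph _ (@normcM R) (@normc1 R)). Qed.

Lemma nat_normc_inj m n : normc (m%:R - n%:R : R[i]) < 1 -> m = n.
Proof.
wlog le_nm : m n / (n <= m)%N => [th|].
  by case: (leqP n m) => [/th//|/ltnW/th th']; rewrite distcC => /th'.
rewrite -natrB // normc_nat -[1]/(1%:R) ltr_nat ltnS leqn0 subn_eq0 => le_mn.
by apply/eqP; rewrite eqn_leq le_mn.
Qed.

End Modulus.

(** * Zero lists of products and logarithmic derivatives *)

Section ZerosTheory.
Variable F : closedFieldType.
Implicit Types (p q : {poly F}).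

Lemma mem_zeros p z : p != 0 -> (z \in zeros p) = root p z.
Proof.
by move=> p0; rewrite [p in RHS]zerosE rootZ ?lead_coef_eq0 // root_prod_XsubC.
Qed.

Lemma size_zeros p : p != 0 -> size (zeros p) = (size p).-1.
Proof.
move=> p0.
by rewrite [p in RHS]zerosE size_scale ?lead_coef_eq0 // size_prod_XsubC.
Qed.

Lemma zerosM p q : p != 0 -> q != 0 ->
  perm_eq (zeros (p * q)) (zeros p ++ zeros q).
Proof.
move=> p0 q0; apply/allP => z _ /=; apply/eqP.
by rewrite count_cat !count_mem_zeros ?mulf_neq0 // mupM.
Qed.

Lemma deriv_horner_zeros p z : p.[z] != 0 ->
  p^`().[z] / p.[z] = \sum_(u <- zeros p) (z - u)^-1.
Proof.
rewrite [in X in X -> _](zerosE p) [in LHS](zerosE p) derivZ !hornerZ.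
rewrite mulf_eq0 negb_or => /andP[a0]; rewrite -mulf_div divff // mul1r.
elim: (zeros p) => [|u s IHs]; first by rewrite !big_nil derivC horner0 mul0r.
rewrite !big_cons derivM derivXsubC mul1r hornerD !hornerM hornerXsubC.
rewrite mulf_eq0 negb_or => /andP[zu s0].
by rewrite -IHs //; field; rewrite zu s0.
Qed.

End ZerosTheory.

(** * Rouche's theorem through averages over roots of unity *)

Section Rouche.
Variable R : realType.
Local Notation C := R[i].
Implicit Types (P Q : {poly C}) (a u v w z : C) (s t x y : R).

(** For [a = rho ^ N] with [rho > 0] these are [N] equally spaced nodes on the circle of radius
    [rho] about 0. *)
Definition circle N a := zeros ('X^N - a%:P).

Lemma circle_neq0 N a : (0 < N)%N -> 'X^N - a%:P != 0 :> {poly C}.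
Proof. by move=> N0; rewrite -size_poly_eq0 size_XnsubC. Qed.

Lemma mem_circle N a z : (0 < N)%N -> (z \in circle N a) = (z ^+ N == a).
Proof.
move=> N0; rewrite mem_zeros ?circle_neq0 // rootE !hornerE subr_eq0.
by [].
Qed.

Lemma normc_circle N (x : R) z : (0 < N)%N -> 0 <= x ->
  z \in circle N (x ^+ N)%:C%C -> normc z = x.
Proof.
move=> N0 x0; rewrite mem_circle // => /eqP /(congr1 (@normc R)).
rewrite normcX normc_real ger0_norm ?exprn_ge0 //.
by apply: (pexpIrn N0); rewrite nnegrE ?normc_ge0.
Qed.

(** Since [z / (z - u) = 1 - u / (u - z)], the sum reduces to the logarithmic derivative of
    [X^N - a] at [u]. *)
Lemma sum_circle N a u : (0 < N)%N -> a != 0 -> u ^+ N != a ->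
  \sum_(z <- circle N a) z / (z - u) = N%:R * (a / (a - u ^+ N)).
Proof.
move=> N0 a0 uNa.
have Tu : ('X^N - a%:P).[u] != 0 by rewrite !hornerE subr_eq0.
have := deriv_horner_zeros Tu; rewrite derivB derivXn derivC subr0 !hornerE.
rewrite hornerMn !hornerE => logd.
rewrite big_seq; under eq_bigr => z.
  rewrite mem_circle // => zNa.
  have zu : z - u != 0.
    by rewrite subr_eq0; apply: contraNneq uNa => <-.
  have -> : z / (z - u) = 1 - u * (u - z)^-1.
    have uz : u - z != 0 by rewrite -opprB oppr_eq0.
    by field; rewrite ?zu ?uz.
  over.
rewrite -big_seq sumrB -mulr_sumr -[circle N a]/(zeros _) -logd.
rewrite big_const_seq count_predT iter_addr addr0 size_zeros ?circle_neq0 //.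
rewrite size_XnsubC //= mulrA mulrnAr -exprS prednK // -[_ *+ N]mulr_natl.
have h1 : u ^+ N - a != 0 by rewrite subr_eq0.
have h2 : a - u ^+ N != 0 by rewrite subr_eq0 eq_sym.
by field; rewrite ?h1 ?h2.
Qed.

(** The trapezoidal rule for the argument-principle integral of [P' / P] over the circle of radius
    [rho] about [w]. *)
Definition mean N (rho : R) w P : C :=
  N%:R^-1 * \sum_(z <- circle N (rho ^+ N)%:C%C) z * (P^`().[w + z] / P.[w + z]).

(* For [v = (u - w) / rho] off the unit circle the summand [1 / (1 - v ^ N)]
   tends to the indicator of [|v| < 1]. *)
Lemma mean_zeros N (rho : R) w P : (0 < N)%N -> 0 < rho ->
  (forall z, normc (z - w) = rho -> P.[z] != 0) ->
  (forall u, u \in zeros P -> (u - w) ^+ N != (rho ^+ N)%:C%C) ->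
  mean N rho w P =
  \sum_(u <- zeros P) (rho ^+ N)%:C%C / ((rho ^+ N)%:C%C - (u - w) ^+ N).
Proof.
move=> N0 rho0 Pn0 zP; rewrite /mean; set a := (rho ^+ N)%:C%C.
have a0 : a != 0 by rewrite -normc_eq0 normc_real normr_eq0 expf_neq0 ?gt_eqF.
have -> : \sum_(z <- circle N a) z * (P^`().[w + z] / P.[w + z]) =
  \sum_(z <- circle N a) \sum_(u <- zeros P) z / (z - (u - w)).
  rewrite big_seq [RHS]big_seq; apply: eq_bigr => z /normc_circle zr.
  rewrite deriv_horner_zeros ?Pn0 //; last by rewrite addrC addKr zr // ltW.
  by rewrite mulr_sumr; apply: eq_bigr => u _; rewrite opprB addrCA addrA.
rewrite exchange_big mulr_sumr big_seq [RHS]big_seq; apply: eq_bigr => u uP.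
by rewrite sum_circle ?zP // mulKf // pnatr_eq0 -lt0n.
Qed.

(** Inside the circle the difference is [v^N / (rho^N - v^N)], outside it is
    [rho^N / (rho^N - v^N)]. Either way the numerator is at most [q^N] times the dominant term of
    the denominator, whose modulus is at least [1 - q^N] times that term. *)
Lemma circle_term_bound N (q rho : R) v : (0 < N)%N -> 0 < rho -> 0 < q < 1 ->
  (normc v <= q * rho) || (rho <= q * normc v) ->
  v ^+ N != (rho ^+ N)%:C%C /\
  normc ((rho ^+ N)%:C%C / ((rho ^+ N)%:C%C - v ^+ N) - (normc v < rho)%R%:R)
    <= q ^+ N / (1 - q ^+ N).
Proof.
move=> N0 rho0 /andP[q0 q1] vq; set a := (rho ^+ N)%:C%C.
have na : normc a = rho ^+ N by rewrite normc_real ger0_norm ?exprn_ge0 ?ltW.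
have qN : 0 < 1 - q ^+ N by rewrite subr_gt0 exprn_ilt1 ?ltW // -lt0n.
have aN0 : 0 < rho ^+ N by rewrite exprn_gt0.
have [vr|vr] := ltP (normc v) rho.
  have {}vq : normc (v ^+ N) <= q ^+ N * rho ^+ N.
    rewrite normcX -exprMn lerXn2r ?nnegrE ?normc_ge0 ?mulr_ge0 ?(ltW q0) ?(ltW rho0) //.
    case/orP: vq => [//|vq].
    have qv : q * normc v < q * rho by rewrite ltr_pM2l.
    have : q * rho < rho by rewrite gtr_pMl.
    by lra.
  have d1 : (1 - q ^+ N) * rho ^+ N <= normc (a - v ^+ N).
    by rewrite (le_trans _ (lerB_normc _ _)) // na mulrBl mul1r lerB.
  have d0 : 0 < normc (a - v ^+ N) by rewrite (lt_le_trans _ d1) // mulr_gt0.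
  have d0' : a - v ^+ N != 0 by rewrite -normc_gt0.
  split; first by rewrite eq_sym -subr_eq0.
  have -> : a / (a - v ^+ N) - 1 = v ^+ N / (a - v ^+ N) by field; rewrite d0'.
  rewrite normcM normcV ler_pdivrMr // (le_trans vq) //.
  rewrite -mulrA ler_wpM2l ?exprn_ge0 ?(ltW q0) //.
    by rewrite ler_pdivlMl.
have {}vq : rho ^+ N <= q ^+ N * normc (v ^+ N).
  rewrite normcX -exprMn lerXn2r ?nnegrE ?mulr_ge0 ?normc_ge0 ?(ltW q0) ?(ltW rho0) //.
  case/orP: vq => [vq|//].
  have qv : q * rho <= q * normc v by rewrite ler_pM2l.
  have : q * rho < rho by rewrite gtr_pMl.
  by lra.
have v0 : 0 < normc (v ^+ N).
  by rewrite -(pmulr_rgt0 _ (exprn_gt0 N q0)) (lt_le_trans aN0).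
have d1 : (1 - q ^+ N) * normc (v ^+ N) <= normc (a - v ^+ N).
  by rewrite distcC (le_trans _ (lerB_normc _ _)) // na mulrBl mul1r lerB.
have d0 : 0 < normc (a - v ^+ N) by rewrite (lt_le_trans _ d1) // mulr_gt0.
have d0' : a - v ^+ N != 0 by rewrite -normc_gt0.
split; first by rewrite eq_sym -subr_eq0.
rewrite subr0 normcM normcV na ler_pdivrMr // (le_trans vq) //.
rewrite -mulrA ler_wpM2l ?exprn_ge0 ?(ltW q0) //.
by rewrite ler_pdivlMl.
Qed.

Lemma mean_count N (q rho : R) w P : (0 < N)%N -> 0 < rho -> 0 < q < 1 ->
  (forall z, normc (z - w) = rho -> P.[z] != 0) ->
  (forall u, u \in zeros P ->
     (normc (u - w) <= q * rho) || (rho <= q * normc (u - w))) ->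
  normc (mean N rho w P - (count (fun u => normc (u - w) < rho) (zeros P))%:R)
    <= (size (zeros P))%:R * (q ^+ N / (1 - q ^+ N)).
Proof.
move=> N0 rho0 q01 P0 Pu; rewrite mean_zeros //; last first.
  by move=> u /Pu /(circle_term_bound N0 rho0 q01)[].
have -> : (count (fun u => normc (u - w) < rho) (zeros P))%:R =
    \sum_(u <- zeros P) (normc (u - w) < rho)%R%:R :> C.
  rewrite -sum1_count natr_sum big_mkcond.
  by apply: eq_bigr => u _; case: ifP.
rewrite -sumrB mulr_natl -(count_predT (zeros P)) -iter_addr_0.
rewrite -big_const_seq.
apply: le_normc_sum => u /Pu /(circle_term_bound N0 rho0 q01)[_].
by [].
Qed.

(** The difference of the quotients is [s - t] times a constant, over the product of the
    denominators; these have modulus at least [normc a - normc h]. *)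
Lemma lip_quot (a h a' h' : C) : normc h < normc a ->
  exists L : R, forall s t : R, 0 <= s <= 1 -> 0 <= t <= 1 ->
  normc ((a' + s%:C%C * h') / (a + s%:C%C * h) -
         (a' + t%:C%C * h') / (a + t%:C%C * h)) <= L * `|s - t|.
Proof.
move=> ha; set m := normc a - normc h.
have m0 : 0 < m by rewrite subr_gt0.
have lb s : 0 <= s <= 1 -> m <= normc (a + s%:C%C * h).
  move=> /andP[s0 s1]; rewrite -[_ * h]opprK (le_trans _ (lerB_normc _ _)) //.
  by rewrite normcN normcM normc_real ger0_norm // lerB // ler_piMl ?normc_ge0.
exists (normc (h' * a - a' * h) / m ^+ 2) => s t s01 t01.
have [ms mt] := (lb s s01, lb t t01).
have s0 : a + s%:C%C * h != 0 by rewrite -normc_gt0 (lt_le_trans m0).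
have t0 : a + t%:C%C * h != 0 by rewrite -normc_gt0 (lt_le_trans m0).
have -> : (a' + s%:C%C * h') / (a + s%:C%C * h) -
         (a' + t%:C%C * h') / (a + t%:C%C * h) =
  (s - t)%:C%C * (h' * a - a' * h) / ((a + s%:C%C * h) * (a + t%:C%C * h)).
  by rewrite rmorphB /=; field; rewrite s0 t0.
rewrite !normcM normcV normcM normc_real -mulrA [leRHS]mulrC.
rewrite ler_wpM2l // ler_wpM2l ?normc_ge0 //.
rewrite lef_pV2 ?posrE ?exprn_gt0 ?mulr_gt0 ?normc_gt0 //.
by rewrite expr2 ler_pM // ltW.
Qed.

Lemma lip_sum (r : seq C) (f : C -> R -> C) :
  (forall z, z \in r -> exists L : R, forall x y : R, 0 <= x <= 1 ->
    0 <= y <= 1 -> normc (f z x - f z y) <= L * `|x - y|) ->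
  exists L : R, forall x y : R, 0 <= x <= 1 ->
    0 <= y <= 1 ->
    normc (\sum_(z <- r) f z x - \sum_(z <- r) f z y) <= L * `|x - y|.
Proof.
elim: r => [_|z r IHs fL].
  by exists 0 => x y _ _; rewrite !big_nil subrr normc0 mul0r.
have [|L1 h1] := fL z; first exact: mem_head.
have [|L2 h2] := IHs; first by move=> u us; apply: fL; rewrite inE us orbT.
exists (L1 + L2) => x y x01 y01; rewrite !big_cons opprD addrACA mulrDl.
by rewrite (le_trans (le_normcD _ _)) // lerD ?h1 ?h2.
Qed.

(** On a subdivision so fine that [f] moves by at most 1/4 per step, consecutive integers [k x]
    differ by at most 3/4, hence coincide. *)
Lemma lip_nat_const (k : R -> nat) (f : R -> C) (L : R) :
  (forall x, 0 <= x <= 1 -> normc (f x - (k x)%:R) <= 1 / 4%:R) ->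
  (forall x y, 0 <= x <= 1 -> 0 <= y <= 1 -> normc (f x - f y) <= L * `|x - y|) ->
  k 0 = k 1.
Proof.
move=> fk fL.
have [M M0 LM] : exists2 M : nat, 0 < M%:R :> R & L / M%:R <= 1 / 4%:R.
  exists (Num.truncn (4%:R * `|L|)).+1; first by rewrite ltr0n.
  rewrite ler_pdivrMr ?ltr0n // (le_trans (ler_norm L)) //.
  by have := truncnS_gt (4%:R * `|L|); lra.
have in01 j : (j <= M)%N -> 0 <= (j%:R / M%:R : R) <= 1.
  by move=> jM; rewrite divr_ge0 ?ler0n //= ler_pdivrMr // mul1r ler_nat.
have step j : (j <= M)%N -> k (j%:R / M%:R) = k 0.
  elim: j => [|j IHj] jM; first by rewrite mul0r.
  rewrite -(IHj (ltnW jM)); apply: (@nat_normc_inj R).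
  have [i1 i2] := (in01 _ jM, in01 _ (ltnW jM)).
  have xy : `|j.+1%:R / M%:R - j%:R / M%:R| = M%:R^-1 :> R.
    rewrite -mulrBl -natr1 addrAC subrr add0r mul1r.
    by rewrite ger0_norm ?invr_ge0 ?ler0n.
  have := fL _ _ i1 i2; have := fk _ i1; have := fk _ i2; rewrite xy.
  set x := j.+1%:R / M%:R; set y := j%:R / M%:R => h1 h2 h3.
  have := le_distcD (f x) (k x)%:R (k y)%:R.
  have := le_distcD (f y) (f x) (k y)%:R.
  rewrite (distcC (k x)%:R (f x)).
  by lra.
by rewrite -(step M) // divff // gt_eqF.
Qed.

Lemma geometric_small (q e : R) (d : nat) : 0 < q < 1 -> 0 < e ->
  exists2 N, (0 < N)%N & d%:R * (q ^+ N / (1 - q ^+ N)) <= e.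
Proof.
move=> /andP[q0 q1] e0.
(* The bound 1/2 gives [1 - q ^ N >= 1/2]; the other one then bounds [2 d q^N] by [e], with [d.+1]
   covering [d = 0]. *)
pose e1 := Num.min (1 / 2%:R) (e / (2%:R * d.+1%:R)).
have e10 : 0 < e1 by rewrite lt_min !divr_gt0 ?mulr_gt0.
have [N N0 qN] : exists2 N, (0 < N)%N & q ^+ N <= e1.
  have q1' : `|q| < 1 by rewrite gtr0_norm.
  have /cvgrPdist_lt /(_ _ e10) [N _ hN] := cvg_expr q1'.
  exists N.+1 => //; have := hN N.+1 (leqnSn N).
  by rewrite sub0r normrN ger0_norm ?exprn_ge0 ?(ltW q0) // => /ltW.
exists N => //.
move: qN; rewrite le_min => /andP[q2 qe].
have qN0 : 0 < q ^+ N by rewrite exprn_gt0.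
rewrite mulrA ler_pdivrMr; last by lra.
have : d.+1%:R * q ^+ N <= e / 2%:R.
  move: qe; rewrite invfM mulrA ler_pdivlMr ?ltr0n // mulrC //.
rewrite -natr1; nra.
Qed.

(** The inequality is asked on a whole annulus: then no polynomial on the segment from [Q] to [P]
    vanishes there, and all their zeros stay a uniform factor [q] away from an intermediate circle
    of radius [rho]. *)
Lemma rouche P Q w (r1 r2 : R) : 0 < r1 -> r1 < r2 ->
  (forall z, r1 <= normc (z - w) <= r2 -> normc (P.[z] - Q.[z]) < normc Q.[z]) ->
  count (fun u => normc (u - w) < r2) (zeros P) =
  count (fun u => normc (u - w) < r2) (zeros Q).
Proof.
move=> r10 r12 PQ.
pose H := P - Q; pose f (t : R) := Q + t%:C%C *: H.
have f0 : f 0 = Q by rewrite /f scale0r addr0.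
have f1 : f 1 = P by rewrite /f scale1r addrC subrK.
have fE t z : (f t).[z] = Q.[z] + t%:C%C * H.[z] by rewrite !hornerE.
have dfE t z : (f t)^`().[z] = Q^`().[z] + t%:C%C * H^`().[z].
  by rewrite derivD derivZ !hornerE.
have HQ z : r1 <= normc (z - w) <= r2 -> normc H.[z] < normc Q.[z].
  by rewrite hornerD hornerN; apply: PQ.
have fn0 t z : 0 <= t <= 1 -> r1 <= normc (z - w) <= r2 -> (f t).[z] != 0.
  move=> /andP[t0 t1] /HQ h; rewrite -normc_gt0 fE -[_ * _]opprK.
  rewrite (lt_le_trans _ (lerB_normc _ _)) // subr_gt0 normcN normcM normc_real.
  by rewrite (le_lt_trans _ h) // ger0_norm // ler_piMl ?normc_ge0.
have [rho [rho0 rho1 rho2]] : exists rho, [/\ 0 < rho, r1 < rho & rho < r2].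
  by exists ((r1 + r2) / 2%:R); split; lra.
have r20 : 0 < r2 by apply: lt_trans rho2.
pose q := Num.max (r1 / rho) (rho / r2).
have q01 : 0 < q < 1.
  apply/andP; split; first by rewrite lt_max divr_gt0.
  by rewrite gt_max !ltr_pdivrMr // !mul1r rho1.
have qr u : (normc u <= r1) || (r2 <= normc u) ->
    (normc u <= q * rho) || (rho <= q * normc u).
  case/orP => h; apply/orP; [left|right].
    by rewrite (le_trans h) // -ler_pdivrMr // le_max lexx.
  rewrite (@le_trans _ _ (q * r2)) // ?ler_wpM2l //; last by case/andP: q01 => /ltW.
  by rewrite -ler_pdivrMr // le_max lexx orbT.
(* [d] bounds the number of zeros of every [f t], so that one [N] serves all [t]. *)
pose d := maxn (size Q) (size H).
have sf t : (size (f t) <= d)%N.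
  rewrite (leq_trans (size_polyD _ _)) // geq_max leq_maxl /=.
  by rewrite (leq_trans (size_scale_leq _ _)) // leq_maxr.
have in_rho z : normc (z - w) = rho -> r1 <= normc (z - w) <= r2.
  by move=> ->; rewrite !ltW.
have fneq0 t : 0 <= t <= 1 -> f t != 0.
  move=> t01; have := fn0 t (w + rho%:C%C) t01.
  rewrite addrAC subrr add0r normc_real gtr0_norm // !ltW // => /(_ isT).
  by apply: contraNneq => ->; rewrite horner0.
have f_ann t u : 0 <= t <= 1 -> u \in zeros (f t) ->
    (normc (u - w) <= r1) || (r2 <= normc (u - w)).
  move=> t01; rewrite mem_zeros ?fneq0 // => /eqP fu.
  apply: contraT; rewrite negb_or -!ltNge => /andP[h1 h2].
  by have := fn0 t u t01; rewrite (ltW h1) (ltW h2) fu eqxx => /(_ isT).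
have [N N0 dN] := geometric_small d q01 (divr_gt0 ltr01 (ltr0Sn R 3)).
have [L mL] : exists L : R, forall x y : R, 0 <= x <= 1 -> 0 <= y <= 1 ->
    normc (mean N rho w (f x) - mean N rho w (f y)) <= L * `|x - y|.
  pose g z x := z * ((f x)^`().[w + z] / (f x).[w + z]).
  have [|L gL] := @lip_sum (circle N (rho ^+ N)%:C%C) g.
    move=> z /(normc_circle N0 (ltW rho0)) zr.
    have [|L hL] := @lip_quot Q.[w + z] H.[w + z] Q^`().[w + z] H^`().[w + z].
      by apply/HQ/in_rho; rewrite addrC addKr.
    exists (rho * L) => x y x01 y01; rewrite -mulrBr normcM zr -mulrA.
    by rewrite ler_wpM2l ?(ltW rho0) // !fE !dfE hL.
  exists (N%:R^-1 * L) => x y x01 y01.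
  rewrite -mulrBr normcM normcV normc_nat -mulrA ler_wpM2l ?invr_ge0 //.
  exact: gL.
rewrite -f1 -f0.
(* The annulus is free of zeros, so the radii [r2] and [rho] count the same ones. *)
have cE t : 0 <= t <= 1 ->
    count (fun u => normc (u - w) < r2) (zeros (f t)) =
    count (fun u => normc (u - w) < rho) (zeros (f t)).
  move=> t01; apply: eq_in_count => u /(f_ann _ _ t01) ua /=.
  by apply/idP/idP; case/orP: ua; lra.
rewrite !cE ?lexx ?ler01 //; apply/esym.
apply: (@lip_nat_const
  (fun t => count (fun u => normc (u - w) < rho) (zeros (f t)))
  (fun t => mean N rho w (f t)) L) => // t t01.
apply: le_trans dN.
apply: le_trans (mean_count N0 rho0 q01 _ _) _.
- by move=> z /in_rho; apply: fn0.
- by move=> u /(f_ann _ _ t01)/qr.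
rewrite ler_wpM2r //; last first.
  rewrite ler_nat size_zeros ?fneq0 // (leq_trans (leq_pred _)) //.
case/andP: q01 => q0 q1.
by rewrite divr_ge0 ?exprn_ge0 ?subr_ge0 ?exprn_ile1 ?ltW.
Qed.

End Rouche.

(** * Recursion for the reversed polynomials *)

Lemma reversed_PhiS (C : numClosedFieldType) (alpha : nat -> C) n :
  reversed n.+1 (Phi alpha n.+1) =
  reversed n (Phi alpha n) - alpha n *: ('X * Phi alpha n).
Proof.
apply/polyP => -[|i].
  rewrite coefB coefZ coefXM !coef_poly /= coefB coefZ coefXM coef_poly.
  by rewrite !subn0 ltnn !mulr0 !subr0.
rewrite coefB coefZ coefXM !coef_poly /= coefB coefZ coefXM coef_poly subSS.
rewrite !ltnS; have [lin|nli] := leqP i n; last first.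
  rewrite ltnNge (ltnW nli) /= (nth_default _ (leq_trans (size_Phi _ _) nli)).
  by rewrite mulr0 subr0.
rewrite leq_subr subKn // rmorphB rmorphM /= !conjCK; congr (_ - _).
case: ltngtP lin => // [lin _|->]; last by rewrite subnn /= conjC0.
by rewrite subn_eq0 leqNgt lin subnS.
Qed.

(** * Perturbed contractions and bounds for infinite products *)

Section RealSequences.
Variable R : realType.
Implicit Types (x y z q e K : R).

Lemma periodic_le (f : nat -> R) p : (0 < p)%N ->
  (forall n, f (n + p)%N = f n) -> exists2 M, 0 < M & forall n, f n <= M.
Proof.
move=> p0 fp.
have fm n m : f (n + m * p)%N = f n.
  by elim: m => [|m IHm]; rewrite ?addn0 // mulSn addnCA addnC fp.
exists (1 + \sum_(k < p) `|f k|) => [|n]; first by rewrite ltr_wpDr ?sumr_ge0.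
rewrite {1}(divn_eq n p) addnC fm; have np := ltn_pmod n p0.
rewrite (bigD1 (Ordinal np)) //= (le_trans (ler_norm _)) //.
by rewrite addrCA lerDl addr_ge0 ?sumr_ge0.
Qed.

(** Iterating from [N0] on, the perturbations sum to at most [e / 2] and the initial value is damped
    geometrically. The parameter [t] makes the conclusion uniform, later for [z] in a disk. *)
Lemma perturbed_contraction (T : Type) (S : T -> Prop) (x : T -> nat -> R) th :
  0 <= th < 1 -> (forall n, exists K, forall t, S t -> x t n <= K) ->
  (forall e, 0 < e -> exists N, forall n t, (N <= n)%N -> S t ->
     x t n.+1 <= th * x t n + e) ->
  forall e, 0 < e -> exists N, forall n t, (N <= n)%N -> S t -> x t n <= e.
Proof.
move=> /andP[th0 th1] bd step e e0.
(* With this perturbation [e / 2] is the fixed point of the affine recursion. *)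
have [|N0 hN0] := step (e / 2%:R * (1 - th)).
  by rewrite mulr_gt0 ?divr_gt0 ?subr_gt0.
have [K hK] := bd N0.
have geo k t : S t -> x t (N0 + k)%N <= e / 2%:R + th ^+ k * `|K|.
  move=> St; elim: k => [|k IHk].
    rewrite addn0 expr0 mul1r (le_trans (hK t St)) // (le_trans (ler_norm K)) //.
    by rewrite lerDr divr_ge0 ?(ltW e0).
  rewrite addnS (le_trans (hN0 _ _ (leq_addr _ _) St)) //.
  have := ler_wpM2l th0 IHk; rewrite exprS mulrDr mulrA; lra.
have [k0 hk0] : exists k0, forall k, (k0 <= k)%N -> th ^+ k * `|K| <= e / 2%:R.
  have th1' : `|th| < 1 by rewrite ger0_norm.
  have e1 : 0 < e / 2%:R / (1 + `|K|) by rewrite !divr_gt0 // ltr_pwDl.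
  have /cvgrPdist_lt /(_ _ e1) [k0 _ hk] := cvg_expr th1'.
  exists k0 => k /hk /=; rewrite sub0r normrN ger0_norm ?exprn_ge0 //.
  rewrite ltr_pdivlMr ?ltr_pwDl // mulrDr mulr1 => /ltW; apply: le_trans.
  by rewrite lerDr exprn_ge0.
exists (N0 + k0)%N => n t ln St.
have -> : n = (N0 + (n - N0))%N by rewrite subnKC // (leq_trans (leq_addr _ _) ln).
apply: le_trans (geo _ _ St) _.
have := hk0 (n - N0)%N; rewrite leq_subRL ?(leq_trans (leq_addr _ _) ln) //.
by move=> /(_ ln); lra.
Qed.

(* With [v n = t n / (1 - q)] one has [a n <= v n - v n.+1], so that the [v]'s
   bound the tails of the series of the [a n]. *)
Lemma summable_product_bounds (a t : nat -> R) q N0 : 0 <= q < 1 ->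
  (forall n, 0 <= a n < 1) -> (forall n, a n <= t n) ->
  (forall n, (N0 <= n)%N -> t n.+1 <= q * t n) ->
  exists k K : R, [/\ 0 < k, 0 < K & forall u : nat -> R, u 0 = 1 ->
    (forall n, 0 <= u n) ->
    (forall n, u n * (1 - a n) <= u n.+1 <= u n * (1 + a n)) ->
    forall n, k <= u n <= K].
Proof.
move=> q01 a01 at_ tq.
have a0 n : 0 <= a n by case/andP: (a01 n).
have a1 n : 0 < 1 - a n by rewrite subr_gt0; case/andP: (a01 n).
have t0 n : 0 <= t n by rewrite (le_trans (a0 n)).
have q1 : 0 < 1 - q by rewrite subr_gt0; case/andP: q01.
pose v n := t n / (1 - q).
have v0 n : 0 <= v n by rewrite divr_ge0 // ltW.
have av n : (N0 <= n)%N -> a n <= v n - v n.+1.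
  move=> ln; rewrite (le_trans (at_ n)) // -mulrBl ler_pdivlMr //.
  by have := tq n ln; lra.
(* From [N] on the tail sum of the [a n] is at most 1/2; the factors before [N] go into the finite
   products [k] and [K]. *)
have [N [lN vN]] : exists N, (N0 <= N)%N /\ v N <= 1 / 2%:R.
  have [|||M hM] := @perturbed_contraction unit xpredT (fun=> v) q q01 _ _ (1 / 2%:R).
  - by move=> n; exists (v n).
  - move=> e e0; exists N0 => n _ ln _.
    rewrite ler_wpDr ?(ltW e0) // mulrA ler_wpM2r ?tq // invr_ge0 ltW //.
  - by rewrite divr_gt0.
  exists (maxn N0 M); split; first exact: leq_maxl.
  by apply: (hM _ tt) => //; rewrite leq_maxr.
pose k := \prod_(j < N) (1 - a j); pose K := \prod_(j < N) (1 + a j).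
have k0 : 0 < k by apply: prodr_gt0.
have K0 : 0 < K by apply: prodr_gt0 => j _; rewrite ltr_pwDl.
exists (k / 2%:R), (K * 2%:R); split; rewrite ?divr_gt0 ?mulr_gt0 //.
move=> u u0 u_ge0 uS.
have uSl n : u n * (1 - a n) <= u n.+1 by case/andP: (uS n).
have uSr n : u n.+1 <= u n * (1 + a n) by case/andP: (uS n).
have first n : (n <= N)%N -> k <= u n <= K.
  move=> nN.
  have lo m : \prod_(j < m) (1 - a j) <= u m.
    elim: m => [|m IHm]; first by rewrite big_ord0 u0.
    by rewrite big_ord_recr /= (le_trans _ (uSl m)) // ler_wpM2r ?(ltW (a1 m)).
  have hi m : u m <= \prod_(j < m) (1 + a j).
    elim: m => [|m IHm]; first by rewrite big_ord0 u0.
    by rewrite big_ord_recr /= (le_trans (uSr m)) // ler_wpM2r // addr_ge0.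
  apply/andP; split.
    apply: le_trans (lo n); rewrite /k -!(big_mkord xpredT (fun j => 1 - a j)).
    rewrite (big_cat_nat (leq0n n) nN) /= ler_piMr //.
      by rewrite prodr_ge0 // => j _; rewrite ltW.
    by rewrite prodr_ile1 // => j _; rewrite (ltW (a1 j)) gerBl a0.
  apply: le_trans (hi n) _; rewrite /K -!(big_mkord xpredT (fun j => 1 + a j)).
  rewrite (big_cat_nat (leq0n n) nN) /= ler_peMr //.
    by rewrite prodr_ge0 // => j _; rewrite addr_ge0.
  elim/big_ind: _ => // [x y x1 y1|j _]; last by rewrite lerDl.
  by rewrite mulr_ege1.
have /andP[kN KN] := first N (leqnn N).
move=> n; have [/first/andP[h1 h2]|/ltnW Nn] := leqP n N; first lra.
have vmono m : v N - v (N + m)%N <= 1 / 2%:R by have := v0 (N + m)%N; lra.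
(* Weierstrass product inequalities, with the partial sum of the [a j] replaced by its bound
   [v N - v (N + m)]. The upper one rests on [(1 + s) * (1 - (d + s)) <= 1 - d] for [d, s >= 0]. *)
have tail m : [/\ 0 <= v N - v (N + m)%N,
    k * (1 - (v N - v (N + m)%N)) <= u (N + m)%N &
    u (N + m)%N * (1 - (v N - v (N + m)%N)) <= K].
  elim: m => [|m [IH0 IH1 IH2]].
    by rewrite addn0 subrr subr0 !mulr1.
  have avm := av _ (leq_trans lN (leq_addr m N)); have v1 := vmono m.+1.
  have lo := le_trans (ler_wpM2r (ltW (a1 (N + m)%N)) IH1) (uSl (N + m)%N).
  have hi := uSr (N + m)%N.
  have um := u_ge0 (N + m)%N; have am := a0 (N + m)%N.
  rewrite addnS in v1 *.
  move: (v N) (v (N + m)%N) (v (N + m).+1) (a (N + m)%N) (u (N + m)%N)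
    (u (N + m).+1) IH0 IH2 avm v1 lo hi um am => x y z s w w' xy H xs v1 lo hi w0 s0.
  have sxy : 0 <= s * (x - y) by rewrite mulr_ge0.
  have sxz : 0 <= s * (x - z) by rewrite mulr_ge0 //; lra.
  split; first by lra.
    by apply: le_trans lo; rewrite -mulrA ler_wpM2l ?(ltW k0) //; lra.
  have hi' : w' * (1 - (x - z)) <= w * (1 + s) * (1 - (x - z)).
    by rewrite ler_wpM2r //; lra.
  apply: le_trans hi' _; apply: le_trans H; rewrite -mulrA ler_wpM2l //; lra.
have [_ h1 h2] := tail (n - N)%N; rewrite subnKC // in h1 h2.
have vn := v0 n.
have vNn : 1 - (v N - v n) >= 1 / 2%:R by lra.
have un := u_ge0 n.
apply/andP; split.
  by apply: le_trans h1; rewrite ler_wpM2l ?(ltW k0) //; lra.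
have := ler_wpM2l un vNn; lra.
Qed.

End RealSequences.

(** * Bounds for the reversed polynomials on the closed unit disk *)

Lemma reversed01 (C : numClosedFieldType) : reversed 0 (1 : {poly C}) = 1.
Proof.
by apply/polyP => -[|i]; rewrite coef_poly ?sub0n !coef1 ?rmorph1 ?rmorph0.
Qed.

Section Szego.
Variables (R : realType) (alpha : nat -> R[i]).
Hypothesis alpha_disk : forall n, `|alpha n| < 1.
Local Notation C := R[i].
Implicit Types (z : C) (n : nat).

Local Notation Ph n := (Phi alpha n).
Local Notation Ps n := (reversed n (Phi alpha n)).

Lemma horner_PhiS n z :
  (Ph n.+1).[z] = z * (Ph n).[z] - (alpha n)^* * (Ps n).[z].
Proof. by rewrite /= !hornerE. Qed.

Lemma horner_reversedS n z :
  (Ps n.+1).[z] = (Ps n).[z] - alpha n * (z * (Ph n).[z]).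
Proof. by rewrite reversed_PhiS !hornerE. Qed.

Lemma normc_alpha_lt1 n : normc (alpha n) < 1.
Proof. by have := alpha_disk n; rewrite normE -ltcR. Qed.

(** The difference of the squared moduli factors as [(1 - |a|^2) (|x|^2 - |y|^2)]. Applied with
    [x = Phi_n^*] and [y = z Phi_n], this is the inductive step for comparing [Phi_n] with
    [Phi_n^*]. *)
Lemma normc_le_dual (a x y : C) : normc a < 1 -> normc y <= normc x ->
  normc (y - a^* * x) <= normc (x - a * y).
Proof.
move=> a1 yx.
have id : `|x - a * y| ^+ 2 - `|y - a^* * x| ^+ 2 =
    (1 - `|a| ^+ 2) * (`|x| ^+ 2 - `|y| ^+ 2).
  by rewrite !normCK !rmorphB !rmorphM /= conjCK; ring.
have idr : normc (x - a * y) ^+ 2 - normc (y - a^* * x) ^+ 2 =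
    (1 - normc a ^+ 2) * (normc x ^+ 2 - normc y ^+ 2).
  by apply: complexI; rewrite rmorphM !rmorphB !rmorphXn rmorph1 /= -!normE.
rewrite -(@ler_pXn2r _ 2%N) ?nnegrE ?normc_ge0 // -subr_ge0 idr mulr_ge0 //.
  by rewrite subr_ge0 exprn_ile1 ?normc_ge0 // ltW.
by rewrite subr_ge0 lerXn2r ?nnegrE ?normc_ge0.
Qed.

Lemma Phi_le_reversed n z : normc z <= 1 ->
  normc (Ph n).[z] <= normc (Ps n).[z].
Proof.
move=> z1; elim: n => [|n IHn].
  by rewrite /= reversed01.
rewrite horner_PhiS horner_reversedS normc_le_dual ?normc_alpha_lt1 //.
by rewrite normcM (le_trans _ IHn) // ler_piMl ?normc_ge0.
Qed.

Lemma reversed_diff n z : normc z <= 1 ->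
  normc ((Ps n.+1).[z] - (Ps n).[z]) <= normc (alpha n) * normc (Ps n).[z].
Proof.
move=> z1; rewrite horner_reversedS addrAC subrr add0r normcN !normcM.
rewrite ler_wpM2l ?normc_ge0 // (le_trans _ (Phi_le_reversed n z1)) //.
by rewrite ler_piMl ?normc_ge0.
Qed.

(** By [reversed_diff], each step changes the modulus by a factor between [1 - |alpha_n|] and
    [1 + |alpha_n|], starting from 1, so the product bounds are uniform in [z]. *)
Lemma reversed_bounds (t : nat -> R) q N0 : 0 <= q < 1 ->
  (forall n, normc (alpha n) <= t n) ->
  (forall n, (N0 <= n)%N -> t n.+1 <= q * t n) ->
  exists k K : R, [/\ 0 < k, 0 < K & forall n z, normc z <= 1 ->
    k <= normc (Ps n).[z] <= K].
Proof.
move=> q01 at_ tq.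
have [|k [K [k0 K0 H]]] := @summable_product_bounds R
  (fun n => normc (alpha n)) t q N0 q01 _ at_ tq.
  by move=> n; rewrite normc_ge0 normc_alpha_lt1.
exists k, K; split=> // n z z1; apply: (H (fun n => normc (Ps n).[z])) => {n}.
- by rewrite /= reversed01 hornerC normc1.
- by move=> n; rewrite normc_ge0.
move=> n; have d := reversed_diff n z1.
have := le_trans (lerB_normc _ _) d.
have := d; rewrite distcC => /(le_trans (lerB_normc _ _)).
by rewrite /=; lra.
Qed.

End Szego.

(** * Periodicity of [c] and the recursion for [W] *)

Section Periodic.
Variables (C : numClosedFieldType) (b : C) (p : nat) (c : int -> C).
Hypothesis p_gt0 : (0 < p)%N.
Hypothesis c_periodic : forall j : int, c (j + p%:Z) = c j.
Hypothesis c_prod : \prod_(1 <= j < p.+1) c j%:Z = 1.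
Implicit Types (j : int) (n l : nat) (z : C).

Lemma c_periodicM j n : c (j + (n * p)%N%:Z) = c j.
Proof.
elim: n => [|n IHn]; first by rewrite mul0n addr0.
by rewrite mulSn addnC PoszD addrA c_periodic.
Qed.

Lemma W_periodic n l : W p b c (n * p + l)%N%:Z = W p b c l%:Z.
Proof.
apply/polyP => k; rewrite !coef_poly; case: ifP => // _; apply: eq_bigr => j _.
by rewrite addnC PoszD addrAC c_periodicM.
Qed.

(** Moving the window by one trades [c (m - p)] for [c m], which are equal; the window below [p.+1]
    is the given period read backwards. *)
Lemma c_prod_window n : \prod_(1 <= j < p.+1) c (n%:Z - j%:Z) = 1.
Proof.
have cst m : \prod_(1 <= j < p.+1) c (m.+1%:Z - j%:Z) =
    \prod_(1 <= j < p.+1) c (m%:Z - j%:Z).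
  rewrite big_ltn // big_add1 /= [RHS]big_nat_recr //= mulrC; congr (_ * _).
    by apply: eq_bigr => j _; congr c; lia.
  by rewrite -(c_periodic (m%:Z - p%:Z)) subrK; congr c; lia.
have {}cst m : \prod_(1 <= j < p.+1) c (m%:Z - j%:Z) =
    \prod_(1 <= j < p.+1) c (0%N%:Z - j%:Z).
  by elim: m => // m <-.
rewrite cst -(cst p.+1) -[RHS]c_prod big_nat_rev /=.
apply: eq_big_nat => j /andP[j1 jp].
by congr c; lia.
Qed.

Lemma c_neq0 n : (0 < n)%N -> c n%:Z != 0.
Proof.
move=> n0.
(* The representative is taken in [1..p], the index range of [c_prod], rather than in [0..p-1]. *)
have -> : n = ((n.-1 %% p).+1 + n.-1 %/ p * p)%N.
  by rewrite addSn addnC -divn_eq prednK.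
rewrite PoszD c_periodicM.
have : \prod_(1 <= j < p.+1) c j%:Z != 0 by rewrite c_prod oner_eq0.
rewrite big_nat prodf_seq_neq0 => /allP/(_ (n.-1 %% p).+1).
have lp : (n.-1 %% p < p)%N by rewrite ltn_pmod.
by rewrite mem_index_iota /= ltnS lp => /(_ isT).
Qed.

(** Multiplication by [z / (b conj c_n)] shifts the coefficients of [W_n] onto those of [W_(n+1)].
    This misses the constant term 1 and adds a term of degree [p], whose coefficient is [1 / b^p]
    because a full window of [c] has product 1. *)
Lemma W_rec n z : (W p b c n.+1%:Z).[z] =
  1 - z ^+ p / b ^+ p + z / (b * (c n%:Z)^*) * (W p b c n%:Z).[z].
Proof.
pose a (l k : nat) := \prod_(1 <= j < k.+1) (b * (c (l%:Z - j%:Z))^*)^-1.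
have aS k : a n.+1 k.+1 = (b * (c n%:Z)^*)^-1 * a n k.
  rewrite /a big_ltn // big_add1 /=; congr (_ * _).
    by congr (_ * (c _)^*)^-1; lia.
  by apply: eq_bigr => j _; congr (_ * (c _)^*)^-1; lia.
have ap : a n.+1 p = (b ^+ p)^-1.
  rewrite /a prodfV big_split /= -rmorph_prod c_prod_window rmorph1 mulr1.
  by rewrite prodr_const_nat subn1.
have a0 l : a l 0%N = 1 by rewrite /a big_geq.
rewrite !horner_poly -/(a _ _).
have -> : z / (b * (c n%:Z)^*) * (\sum_(i < p) a n i * z ^+ i) =
   \sum_(i < p) a n.+1 i.+1 * z ^+ i.+1.
  rewrite mulr_sumr; apply: eq_bigr => i _; rewrite aS exprS.
  by rewrite -!mulrA mulrCA; congr (_ * _); rewrite mulrCA.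
apply: (addIr ((b ^+ p)^-1 * z ^+ p)).
have := erefl (\sum_(i < p.+1) a n.+1 i * z ^+ i).
rewrite [LHS]big_ord_recr big_ord_recl /= a0 ap expr0 mulr1 => ->.
by rewrite [z ^+ p / _]mulrC addrAC subrK.
Qed.

End Periodic.

(** * Uniformity over finitely many residues, and bounds on polynomial values *)

Lemma eventually_finite p (P : nat -> nat -> Prop) :
  (forall l, (1 <= l <= p)%N -> exists N, forall m, (N <= m)%N -> P l m) ->
  exists N, forall l m, (1 <= l <= p)%N -> (N <= m)%N -> P l m.
Proof.
elim: p => [_|p IHp H]; first by exists 0%N => -[|l].
have [|N1 h1] := IHp.
  by move=> l /andP[l1 lp]; apply: H; rewrite l1 leqW.
have [|N2 h2] := H p.+1; first by rewrite leqnn.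
exists (maxn N1 N2) => l m /andP[l1]; rewrite geq_max => lp /andP[m1 m2].
move: lp; rewrite leq_eqVlt => /predU1P[->|lp]; first exact: h2.
by apply: h1; rewrite // l1.
Qed.

Section PolyBounds.
Variable R : rcfType.
Implicit Types (P : {poly R[i]}) (z : R[i]).

Lemma horner_le_sum P z : normc z <= 1 ->
  normc P.[z] <= \sum_(i < size P) normc P`_i.
Proof.
move=> z1; rewrite horner_coef; apply: le_normc_sum => i _.
rewrite normcM normcX ler_piMr ?normc_ge0 //.
by rewrite exprn_ile1 ?normc_ge0.
Qed.

(** Replaces a compactness argument: the lower bound away from the zeros is explicit in the
    factorisation. *)
Lemma horner_ge_lead P z eta : 0 <= eta ->
  (forall w, w \in zeros P -> eta <= normc (z - w)) ->
  normc (lead_coef P) * eta ^+ size (zeros P) <= normc P.[z].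
Proof.
move=> e0 zw; rewrite [P in leRHS]zerosE hornerZ normcM.
rewrite ler_wpM2l ?normc_ge0 // horner_prod normc_prod.
elim: (zeros P) zw => [_|w s IHs zw]; first by rewrite big_nil.
rewrite big_cons exprS ler_pM ?exprn_ge0 //.
  by rewrite hornerXsubC zw ?mem_head.
by apply: IHs => u us; apply: zw; rewrite inE us orbT.
Qed.

End PolyBounds.

(** * Decay of the coefficients and asymptotics of [Phi] in [|z| < b] *)

Section Asymptotics.
Variables (R : realType) (alpha : nat -> R[i]) (b : R) (p : nat).
Variable c : int -> R[i].
Hypothesis alpha_disk : forall n, `|alpha n| < 1.
Hypotheses (b_gt0 : 0 < b) (b_lt1 : b < 1) (p_gt0 : (0 < p)%N).
Hypothesis c_periodic : forall j : int, c (j + p%:Z) = c j.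
Hypothesis c_prod : \prod_(1 <= j < p.+1) c j%:Z = 1.
Hypothesis alpha_ratio : forall l : nat, (1 <= l <= p)%N ->
  (alpha (m * p + l)%N / alpha (m * p + l).-1 : R[i]^o) @[m --> \oo]
    --> (b%:C%C * c l%:Z : R[i]^o).
Local Notation C := R[i].
Local Notation bC := (b%:C%C).
Local Notation Ph n := (Phi alpha n).
Local Notation Ps n := (reversed n (Phi alpha n)).
Local Notation Wn n := (W p bC c n%:Z).
Implicit Types (z : C) (n m l : nat) (e : R).

Let cn0 n : c n.+1%:Z != 0.
Proof. exact: (c_neq0 p_gt0 c_periodic c_prod). Qed.

Let bC0 : bC != 0.
Proof. by rewrite -normc_gt0 normc_real gtr0_norm. Qed.

Let bcn0 n : bC * c n.+1%:Z != 0.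
Proof. by rewrite mulf_neq0. Qed.

Lemma ratio_to1 e : 0 < e -> exists N, forall n, (N <= n)%N ->
  normc (alpha n.+1 / (alpha n * (bC * c n.+1%:Z)) - 1) <= e.
Proof.
move=> e0.
have [|N hN] := @eventually_finite p (fun l m =>
    normc (alpha (m * p + l)%N / alpha (m * p + l).-1 - bC * c l%:Z)
      <= e * normc (bC * c l%:Z)).
  move=> [//|l] lp.
  have e1 : 0 < (e * normc (bC * c l.+1%:Z))%:C%C.
    by rewrite (ltcR 0) mulr_gt0 // normc_gt0.
  have /cvgrPdist_lt /(_ _ e1) [N _ hN] := alpha_ratio lp.
  exists N => m /hN /=; rewrite distrC normE ltcR => /ltW.
  by [].
(* Write [n.+1 = m p + l] with [m = n %/ p] and [l = (n %% p).+1], so that [1 <= l <= p] and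
   [m >= N]. *)
exists (N * p)%N => n Nn.
have nE : n = (n %/ p * p + (n %% p))%N by rewrite -divn_eq.
have := hN (n %% p).+1 (n %/ p)%N; rewrite ltn_pmod //= leq_divRL //.
rewrite addnS /= -nE => /(_ isT Nn).
have cE : c n.+1%:Z = c (n %% p).+1%:Z.
  by rewrite {1}nE addnC -addSn PoszD (c_periodicM c_periodic).
rewrite -cE => h.
have -> : alpha n.+1 / (alpha n * (bC * c n.+1%:Z)) - 1 =
  (alpha n.+1 / alpha n - bC * c n.+1%:Z) / (bC * c n.+1%:Z).
  by rewrite mulrBl divff // invfM mulrA.
by rewrite normcM normcV ler_pdivrMr ?normc_gt0.
Qed.

(** If [alpha n = 0], the quotient in [ratio_to1] takes the default value 0, at distance 1 from its
    limit. *)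
Lemma alpha_neq0 : exists N, forall n, (N <= n)%N -> alpha n != 0.
Proof.
have [|N hN] := @ratio_to1 (1 / 2%:R); first by rewrite divr_gt0.
exists N => n /hN; apply: contraTneq => ->.
by rewrite mul0r invr0 mulr0 sub0r normcN normc1 -ltNge; lra.
Qed.

Lemma inv_ratio_to1 e : 0 < e -> exists N, forall n, (N <= n)%N ->
  normc (alpha n * (bC * c n.+1%:Z) / alpha n.+1 - 1) <= e.
Proof.
(* The bound 1/2 forces [normc x >= 1/2] for the ratio [x], whence [|1/x - 1| <= 2 |x - 1|]. *)
move=> e0; pose e1 := Num.min (1 / 2%:R) (e / 2%:R).
have [|N hN] := @ratio_to1 e1; first by rewrite lt_min !divr_gt0.
exists N => n /hN; rewrite -[alpha n * _ / _]invf_div.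
move: (alpha n.+1 / _) => x; rewrite le_min => /andP[x1 x2].
have nx : 1 / 2%:R <= normc x.
  have := lerB_normc 1 (1 - x); rewrite opprB addrCA subrr addr0 normc1.
  by rewrite (distcC 1); lra.
have x0 : x != 0 by rewrite -normc_gt0; lra.
have -> : x^-1 - 1 = (1 - x) / x by rewrite mulrBl divff // mul1r.
rewrite normcM normcV distcC ler_pdivrMr ?normc_gt0 // (le_trans x2) //.
nra.
Qed.

(** This weight absorbs the moduli of the [c_j], which individually may exceed [1 / b]. It is
    periodic, hence bounded above and away from 0. *)
Definition gauge n := \prod_(1 <= j < n.+1) normc (c j%:Z).

Lemma gaugeS n : gauge n.+1 = gauge n * normc (c n.+1%:Z).
Proof. by rewrite /gauge big_nat_recr. Qed.

Lemma gauge_gt0 n : 0 < gauge n.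
Proof.
elim: n => [|n IHn]; first by rewrite /gauge big_geq.
by rewrite gaugeS mulr_gt0 ?normc_gt0.
Qed.

Lemma gauge_periodic n : gauge (n + p) = gauge n.
Proof.
elim: n => [|n IHn].
  by rewrite add0n /gauge -normc_prod c_prod normc1 big_geq.
by rewrite addSn !gaugeS IHn -addSn PoszD c_periodic.
Qed.

Lemma gauge_bounds : exists m M : R, [/\ 0 < m, 0 < M &
  forall n, m <= gauge n <= M].
Proof.
have [M M0 hM] := periodic_le p_gt0 gauge_periodic.
have [|m m0 hm] := @periodic_le R (fun n => (gauge n)^-1) p p_gt0.
  by move=> n; rewrite gauge_periodic.
exists m^-1, M; rewrite invr_gt0; split=> // n; rewrite hM andbT.
by rewrite -[gauge n]invrK lef_pV2 ?posrE ?invr_gt0 ?gauge_gt0.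
Qed.

(** The ratios of [|alpha_n| / gauge n] tend to [b], so they are eventually at most [(1 + b) / 2];
    the factor [M] makes the sequence dominate [|alpha_n|]. *)
Lemma alpha_geometric : exists (t : nat -> R) q N, [/\ 0 <= q < 1,
  forall n, normc (alpha n) <= t n &
  forall n, (N <= n)%N -> t n.+1 <= q * t n].
Proof.
have [m [M [m0 M0 mM]]] := gauge_bounds.
(* The tolerance [e] solving [b (1 + e) = (1 + b) / 2]. *)
have e0 : 0 < (1 - b) / (2%:R * b) by rewrite divr_gt0 ?subr_gt0 ?mulr_gt0.
have [N1 hN] := ratio_to1 e0; have [N2 a0] := alpha_neq0.
exists (fun n => M * (normc (alpha n) / gauge n)), ((1 + b) / 2%:R), (maxn N1 N2).
have ba := b_gt0; have bb := b_lt1.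
split; first by apply/andP; split; lra.
  move=> n; have [_ gM] := andP (mM n).
  by rewrite mulrCA ler_peMr ?normc_ge0 // ler_pdivlMr ?gauge_gt0 // mul1r.
move=> n; rewrite geq_max => /andP[/hN h1 /a0 an0].
rewrite [leRHS]mulrCA ler_wpM2l ?(ltW M0) // ler_pdivrMr ?gauge_gt0 // gaugeS.
have -> : (1 + b) / 2%:R * (normc (alpha n) / gauge n) *
    (gauge n * normc (c n.+1%:Z)) =
    (1 + b) / 2%:R * (normc (alpha n) * normc (c n.+1%:Z)).
  by field; rewrite gt_eqF ?gauge_gt0.
have -> : alpha n.+1 = (1 + (alpha n.+1 / (alpha n * (bC * c n.+1%:Z)) - 1)) *
    bC * (alpha n * c n.+1%:Z).
  by rewrite addrCA subrr addr0 -mulrA (mulrCA bC) divfK // mulf_neq0.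
rewrite !normcM normc_real (gtr0_norm b_gt0).
rewrite ler_wpM2r ?mulr_ge0 ?normc_ge0 //.
rewrite -ler_pdivlMr // (le_trans (le_normcD _ _)) // normc1.
rewrite (le_trans (lerD (lexx _) h1)) //.
have -> : (1 - b) / (2%:R * b) = ((1 - b) / 2%:R) / b by rewrite invfM mulrA.
by rewrite ler_pdivlMr // mulrDl divfK ?gt_eqF //; lra.
Qed.

Lemma alpha_to0 e : 0 < e -> exists N, forall n, (N <= n)%N ->
  normc (alpha n) <= e.
Proof.
move=> e0; have [t [q [N [q01 at_ tq]]]] := alpha_geometric.
have [|||N1 hN] := @perturbed_contraction R unit xpredT (fun=> t) q q01 _ _ e.
- by move=> n; exists (t n).
- by move=> e' e0'; exists N => n _ ln _; rewrite ler_wpDr ?(ltW e0') ?tq.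
- by [].
exists N1 => n Nn; exact: le_trans (at_ n) (hN n tt Nn isT).
Qed.

Lemma W_bounded : exists2 M : R, 0 < M & forall n z, normc z <= 1 ->
  normc (Wn n).[z] <= M.
Proof.
have [|M M0 hM] :=
    @periodic_le R (fun n => \sum_(i < size (Wn n)) normc (Wn n)`_i) p p_gt0.
  by move=> n; rewrite addnC -[X in (X + n)%N]mul1n W_periodic.
by exists M => // n z z1; apply: le_trans (hM n); apply: horner_le_sum.
Qed.

(** The full power series with the coefficients of [W], continued beyond degree [p - 1], sums to [W]
    divided by this factor, whose zeros lie on [|z| = b]. *)
Definition pole_factor : {poly C} := 1 - (bC ^+ p)^-1 *: 'X^p.

Lemma horner_pole_factor z : pole_factor.[z] = 1 - z ^+ p / bC ^+ p.
Proof. by rewrite !hornerE mulrC. Qed.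

Definition error n : {poly C} :=
  pole_factor * (- ((alpha n)^*)^-1 *: Ph n.+1) - Wn n.+1 * Ps n.

(** After [W_rec] and [horner_PhiS] the two terms [(1 - z^p / b^p) Phi_(n+1)^*] cancel, and a factor
    [z] remains throughout. By [inv_ratio_to1], [y] tends to 1. *)
Lemma error_rec n z : alpha n != 0 -> alpha n.+1 != 0 ->
  let y := alpha n * (bC * c n.+1%:Z) / alpha n.+1 in
  (error n.+1).[z] = z / (bC * (c n.+1%:Z)^*) *
    (y^* * (error n).[z] + (Wn n.+1).[z] * (y^* * (Ps n).[z] - (Ps n.+1).[z])).
Proof.
move=> a0 a1 y.
have -> : y^* = (alpha n)^* * (bC * (c n.+1%:Z)^*) / (alpha n.+1)^*.
  have bJ : bC^* = bC by apply/CrealP/ger0_real; rewrite (lecR 0) ltW.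
  by rewrite /y !rmorphM /= fmorphV /= bJ.
rewrite /error !hornerD !hornerN !hornerM !hornerZ horner_pole_factor.
rewrite (W_rec bC p_gt0 c_periodic c_prod n.+1) [(Ph n.+2).[z]]horner_PhiS.
have x0 : (alpha n)^* != 0 by rewrite conjC_eq0.
have x1 : (alpha n.+1)^* != 0 by rewrite conjC_eq0.
have x2 : (c n.+1%:Z)^* != 0 by rewrite conjC_eq0.
have x3 := bC0.
move: (Wn n.+1).[z] (Ps n).[z] (Ps n.+1).[z] (Ph n.+1).[z] => u v w f.
have x4 : bC ^+ p != 0 by rewrite expf_neq0.
move: (bC ^+ p) (z ^+ p) x4 => s t x4.
by field; rewrite x0 x1 x2 x3 x4.
Qed.

Lemma error_to0 r : 0 <= r < b -> forall e, 0 < e ->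
  exists N, forall n z, (N <= n)%N -> normc z <= r -> normc (error n).[z] <= e.
Proof.
move=> /andP[r0 rb].
have r1 : r < 1 by rewrite (lt_trans rb).
have [g [G [g0 G0 gG]]] := gauge_bounds.
have [M M0 hM] := W_bounded.
have [t [q [N0 [q01 at_ tq]]]] := alpha_geometric.
have [k [K [k0 K0 kK]]] := reversed_bounds alpha_disk q01 at_ tq.
pose s := r / b.
have s0 : 0 <= s by rewrite divr_ge0 // ltW.
have s1 : s < 1 by rewrite ltr_pdivrMr // mul1r.
have th01 : 0 <= (1 + s) / 2%:R < 1 by apply/andP; split; lra.
have H e : 0 < e -> exists N, forall n z, (N <= n)%N -> normc z <= r ->
    gauge n * normc (error n).[z] <= e.
  move: e; apply: (perturbed_contraction (x := fun z n => _) th01).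
  - move=> n; exists (G * \sum_(i < size (error n)) normc (error n)`_i) => z zr.
    have [_ gn] := andP (gG n).
    rewrite ler_pM ?normc_ge0 ?(ltW (gauge_gt0 n)) //.
    by rewrite horner_le_sum // (le_trans zr) // ltW.
  - move=> e e0.
    (* [L] collects the bounds on the gauge, on [W] and on [Phi_n^*]; two errors of [e / (2 L)] then
       add up to at most [e]. The tolerance [(1 - s) / 2] works since
       [s (1 + (1 - s) / 2) <= (1 + s) / 2], which is [(1 - s)^2 >= 0]. *)
    pose L := G * M * K.
    have L0 : 0 < L by rewrite !mulr_gt0.
    have [|N1 hN1] := @inv_ratio_to1 (Num.min ((1 - s) / 2%:R) (e / (2%:R * L))).
      by rewrite lt_min !divr_gt0 ?subr_gt0 ?mulr_gt0.
    have [|N2 hN2] := @alpha_to0 (e / (2%:R * L)).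
      by rewrite divr_gt0 ?mulr_gt0.
    have [N3 hN3] := alpha_neq0.
    exists (maxn N1 (maxn N2 N3)) => n z; rewrite !geq_max => /and3P[n1 n2 n3] zr.
    have z1 : normc z <= 1 by rewrite (le_trans zr) // ltW.
    have := hN1 n n1; rewrite le_min => /andP[y1 y2].
    have a2 := hN2 n n2.
    rewrite error_rec ?hN3 ?leqW //.
    set y := _ / _ in y1 y2 *.
    set E := (error n).[z]; set D := y^* * _ - _.
    have nD : normc D <= e / L * K.
      (* The first part is small because [y] tends to 1, the second because [alpha] tends to 0. *)
      have -> : D = (y - 1)^* * (Ps n).[z] - ((Ps n.+1).[z] - (Ps n).[z]).
        by rewrite /D rmorphB rmorph1; ring.
      rewrite (le_trans (le_normcB _ _)) // normcM normc_conj.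
      have [_ PK] := andP (kK n z z1).
      have d1 := ler_pM (normc_ge0 _) (normc_ge0 _) y2 PK.
      have d2 := le_trans (reversed_diff alpha_disk n z1)
        (ler_pM (normc_ge0 _) (normc_ge0 _) a2 PK).
      rewrite (le_trans (lerD d1 d2)) // -mulrDl ler_wpM2r ?(ltW K0) //.
      have -> : e / (2%:R * L) + e / (2%:R * L) = e / L by field; rewrite gt_eqF.
      exact: lexx.
    have ny : normc y^* <= 1 + (1 - s) / 2%:R.
      rewrite normc_conj -[y](subrK 1) (le_trans (le_normcD _ _)) // normc1.
      by rewrite addrC lerD2l.
    (* The new factor of the gauge cancels the modulus of [c_(n+1)] in the denominator. *)
    have step1 : gauge n.+1 * normc (z / (bC * (c n.+1%:Z)^*)) <= gauge n * s.
      rewrite gaugeS !normcM normcV normcM normc_conj normc_real (gtr0_norm b_gt0).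
      rewrite -mulrA ler_wpM2l ?(ltW (gauge_gt0 n)) //.
      have -> : normc (c n.+1%:Z) * (normc z / (b * normc (c n.+1%:Z))) = normc z / b.
        by field; rewrite gt_eqF // gt_eqF ?normc_gt0.
      by rewrite ler_wpM2r // invr_ge0 ltW.
    rewrite normcM mulrA (le_trans (ler_wpM2r (normc_ge0 _) step1)) //.
    have step2 : normc (y^* * E + (Wn n.+1).[z] * D) <=
        (1 + (1 - s) / 2%:R) * normc E + M * (e / L * K).
      rewrite (le_trans (le_normcD _ _)) // !normcM lerD //.
        by rewrite ler_wpM2r ?normc_ge0.
      by rewrite ler_pM ?normc_ge0 ?hM.
    have [_ gn] := andP (gG n).
    have gs0 : 0 <= gauge n * s by rewrite mulr_ge0 // ltW // gauge_gt0.
    rewrite (le_trans (ler_wpM2l gs0 step2)) // mulrDr lerD //.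
      rewrite [gauge n * s]mulrC mulrACA ler_wpM2r //; last by nra.
      by rewrite mulr_ge0 ?normc_ge0 // ltW // gauge_gt0.
    have -> : M * (e / L * K) = e / G.
      by rewrite /L; field; rewrite !gt_eqF.
    rewrite mulrCA ger_pMr // ler_pdivrMr // mul1r.
    by rewrite (le_trans _ gn) // ler_piMr // ltW // gauge_gt0.
move=> e e0; have [|N hN] := H (g * e); first by rewrite mulr_gt0.
exists N => n z Nn zr; have h := hN n z Nn zr.
have [gn _] := andP (gG n).
rewrite -(ler_pM2l g0); apply: le_trans h.
by rewrite ler_wpM2r ?normc_ge0.
Qed.

Lemma reversed_lower : exists2 k : R, 0 < k &
  forall n z, normc z <= 1 -> k <= normc (Ps n).[z].
Proof.
have [t [q [N0 [q01 at_ tq]]]] := alpha_geometric.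
have [k [K [k0 K0 kK]]] := reversed_bounds alpha_disk q01 at_ tq.
by exists k => // n z /(kK n) /andP[].
Qed.

(** The difference is exactly [- conj alpha_n] times the error. Where [|W| >= mu] the right side is
    at least [|alpha_n| k mu], so an error of at most half of [k mu] suffices. *)
Lemma Phi_approx r mu : 0 <= r < b -> 0 < mu ->
  exists N, forall n z, (N <= n)%N -> normc z <= r ->
  mu <= normc (Wn n.+1).[z] ->
  normc ((pole_factor * Ph n.+1).[z] - (- (alpha n)^* *: Ps n * Wn n.+1).[z])
    < normc (- (alpha n)^* *: Ps n * Wn n.+1).[z].
Proof.
move=> rb mu0; have [k k0 hk] := reversed_lower.
have [N1 hN1] := error_to0 rb (mulr_gt0 (divr_gt0 mu0 (ltr0Sn R 1)) k0).
have [N2 hN2] := alpha_neq0.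
have [/andP[r0 rb'] b1] := (rb, b_lt1).
exists (maxn N1 N2) => n z; rewrite geq_max => /andP[n1 n2] zr muW.
have a0 := hN2 n n2; have a0' : (alpha n)^* != 0 by rewrite conjC_eq0.
have -> : (pole_factor * Ph n.+1).[z] - (- (alpha n)^* *: Ps n * Wn n.+1).[z] =
    - (alpha n)^* * (error n).[z].
  rewrite /error !(hornerD, hornerN, hornerM, hornerZ); field.
  by rewrite a0' expf_neq0.
rewrite hornerM hornerZ -mulrA !normcM normcN normc_conj.
rewrite ltr_pM2l ?normc_gt0 // (le_lt_trans (hN1 n z n1 zr)) //.
have h1 := hk n z (le_trans zr (ltW (lt_trans rb' b1))).
rewrite mulrC (@lt_le_trans _ _ (k * mu)) //; last by rewrite ler_pM // ltW.
by rewrite ltr_pM2l //; lra.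
Qed.

End Asymptotics.

(** * Localisation of zeros in the style of Hurwitz *)

Section Hurwitz.
Variable R : realType.
Local Notation C := R[i].
Implicit Types (f g T V : {poly C}) (z w u : C).

Lemma finite_lower_bound (I : eqType) (r : seq I) (F : I -> R) :
  (forall i, i \in r -> 0 < F i) ->
  exists2 d, 0 < d & forall i, i \in r -> d <= F i.
Proof.
elim: r => [_|i r IHr Fr]; first by exists 1.
have [|d d0 hd] := IHr; first by move=> j jr; apply: Fr; rewrite inE jr orbT.
exists (Num.min d (F i)); first by rewrite lt_min d0 Fr ?mem_head.
by move=> j; rewrite inE ge_min => /predU1P[->|/hd->]; rewrite ?lexx ?orbT.
Qed.

(** The factor 2 leaves room: closed [d]-disks about the listed zeros stay in [|z| <= b - d] and
    within distance [d] of no other zero, except possibly on the boundary. *)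
Lemma zeros_isolated g (b : R) : exists2 d : R, 0 < d &
  forall w, w \in zeros g -> normc w < b -> normc w + 2%:R * d <= b /\
  forall u, u \in zeros g -> u != w -> 2%:R * d <= normc (u - w).
Proof.
have [|d1 d10 hd1] := @finite_lower_bound _
    [seq w <- zeros g | normc w < b] (fun w => b - normc w).
  by move=> w; rewrite mem_filter subr_gt0 => /andP[].
have [|d2 d20 hd2] := @finite_lower_bound _
    [seq v <- [seq (u, w) | u <- zeros g, w <- zeros g] | v.1 != v.2]
    (fun v => normc (v.1 - v.2)).
  by move=> v; rewrite mem_filter normc_gt0 subr_eq0 => /andP[].
exists (Num.min d1 d2 / 2%:R); first by rewrite divr_gt0 // lt_min d10.
have dE : 2%:R * (Num.min d1 d2 / 2%:R) = Num.min d1 d2.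
  by rewrite mulrC divfK // pnatr_eq0.
move=> w wg wb; rewrite dE; split=> [|u ug uw].
  rewrite -lerBrDl (le_trans _ (hd1 w _)) ?ge_min ?lexx //.
  by rewrite mem_filter wb.
rewrite (le_trans _ (hd2 (u, w) _)) ?ge_min ?lexx ?orbT //.
by rewrite mem_filter uw allpairs_f.
Qed.

(** [mu] is the explicit lower bound for [|g|] at distance at least [d / 2] from its zeros. It is
    fixed before [f], [T] and [V], so one [mu] serves a whole sequence of polynomials. *)
Lemma hurwitz g (b : R) : g != 0 -> 0 < b ->
  exists2 d0 : R, 0 < d0 & forall d, 0 < d -> d < d0 ->
  exists2 mu : R, 0 < mu & forall f T V, f != 0 ->
    (forall z, normc z < b -> T.[z] != 0 /\ V.[z] != 0) ->
    (forall z, normc z <= b - d -> mu <= normc g.[z] ->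
      normc ((T * f).[z] - (V * g).[z]) < normc (V * g).[z]) ->
    let ws := [seq w <- zeros g | `|w| < b%:C%C] in
    let zs := [seq z <- zeros f | `|z| < (b - d)%:C%C] in
    (forall z, z \in zs -> exists2 w, w \in ws & `|z - w| < d%:C%C) /\
    (forall w, w \in ws ->
       count (fun z => `|z - w| < d%:C%C) zs = count_mem w ws).
Proof.
move=> g0 b0; have [d0 d00 iso] := zeros_isolated g b.
exists d0 => // d d1 dd0.
exists (normc (lead_coef g) * (d / 2%:R) ^+ size (zeros g)).
  by rewrite mulr_gt0 ?normc_gt0 ?lead_coef_eq0 // exprn_gt0 // divr_gt0.
move=> f T V f0 TV fg /=.
have [T0 V0] : T != 0 /\ V != 0.
  have [h1 h2] := TV 0 (eq_ind_r (fun x => x < b) b0 (normc0 R)).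
  by split; [apply: contraNneq h1 | apply: contraNneq h2] => ->; rewrite horner0.
have ltE (z : C) (x : R) : (`|z| < x%:C%C) = (normc z < x).
  by rewrite normE ltcR.
have d2 : 0 <= d / 2%:R by rewrite divr_ge0 // ltW.
split.
  move=> z; rewrite mem_filter ltE mem_zeros // => /andP[zb /rootP fz].
  case: (boolP (has (fun w => normc (z - w) < d) [seq w <- zeros g | normc w < b])).
    case/hasP => w; rewrite mem_filter => /andP[wb wg] zw.
    by exists w; rewrite ?mem_filter ltE ?wb.
  move=> /hasPn far.
  (* At a zero of [f] the comparison would read [|V g| < |V g|]. Zeros of [g] with modulus at least
     [b] are far from [z] because [|z| < b - d]. *)
  suff /(fg z (ltW zb)) : normc (lead_coef g) * (d / 2%:R) ^+ size (zeros g) <=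
      normc g.[z].
    by rewrite hornerM fz mulr0 sub0r normcN ltxx.
  apply: horner_ge_lead => // w wg.
  have [wb|bw] := ltP (normc w) b.
    have := far w; rewrite mem_filter wb -leNgt => /(_ wg); lra.
  have := lerB_normc w z; rewrite distcC; lra.
move=> w; rewrite mem_filter ltE => /andP[wb wg].
have [wd wu] := iso w wg wb.
rewrite !count_filter.
have -> : count (predI (fun z => `|z - w| < d%:C%C)
    (fun z => `|z| < (b - d)%:C%C)) (zeros f) =
    count (fun z => normc (z - w) < d) (zeros f).
  apply: eq_count => z /=; rewrite !ltE.
  have := le_normcD (z - w) w; rewrite subrK => zw.
  by case: ltP => //= h; rewrite ltNge; apply/negP; lra.
have -> : count (predI (pred1 w) (fun z => `|z| < b%:C%C)) (zeros g) =
    count (fun z => normc (z - w) < d) (zeros g).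
  apply: eq_in_count => u ug /=; rewrite ltE.
  have [->|uw] := eqVneq u w; first by rewrite subrr normc0 d1 wb.
  by have := wu u ug uw; case: ltP => //= h1 h2; lra.
have away (h : {poly C}) : (forall z, normc z < b -> h.[z] != 0) -> h != 0 ->
    count (fun z => normc (z - w) < d) (zeros h) = 0%N.
  move=> hz h0; rewrite -(count_pred0 (zeros h)); apply: eq_in_count => z /=.
  rewrite mem_zeros // => /rootP hz0; apply/negP => zw.
  have := le_normcD (z - w) w; rewrite subrK => zw'.
  have zb : normc z < b by lra.
  by have := hz z zb; rewrite hz0 eqxx.
have cM (h1 h2 : {poly C}) : h1 != 0 -> h2 != 0 ->
    count (fun z => normc (z - w) < d) (zeros (h1 * h2)) =
    (count (fun z => normc (z - w) < d)%R (zeros h1) +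
     count (fun z => normc (z - w) < d)%R (zeros h2))%N.
  by move=> h10 h20; rewrite (seq.permP (zerosM h10 h20)) count_cat.
(* On the annulus [d / 2 <= |z - w| <= d] every zero of [g] is at distance at least [d / 2], so the
   comparison holds; [T] and [V] contribute no zeros. *)
have := @rouche R (T * f) (V * g) w (d / 2%:R) d.
rewrite !cM // (away T) ?(away V) ?add0n // => [|z /TV[]|z /TV[]] //.
apply; rewrite ?divr_gt0 //; first by lra.
move=> z /andP[zd1 zd2]; apply: fg.
  by have := le_normcD (z - w) w; rewrite subrK; lra.
apply: horner_ge_lead => // u ug.
have [->|uw] := eqVneq u w; first by [].
have := wu u ug uw; have := le_distcD z u w; rewrite (distcC u z); lra.
Qed.

End Hurwitz.

(** * Uniformity in the residue and conclusion *)

Lemma reversed0 (C : numClosedFieldType) n : reversed n (0 : {poly C}) = 0.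
Proof. by apply/polyP => i; rewrite coef_poly !coef0 rmorph0 if_same. Qed.

Lemma delta_finite (R : realType) p (P : nat -> nat -> R -> Prop) :
  (forall l, (1 <= l <= p)%N -> exists2 d0 : R, 0 < d0 &
    forall d, 0 < d -> d < d0 -> exists N, forall m, (N <= m)%N -> P l m d) ->
  exists2 d0 : R, 0 < d0 & forall d, 0 < d -> d < d0 ->
    exists N, forall l m, (1 <= l <= p)%N -> (N <= m)%N -> P l m d.
Proof.
move=> H; suff [d0 d00 hd0] : exists2 d0 : R, 0 < d0 & forall d, 0 < d ->
    d < d0 -> forall l, (1 <= l <= p)%N -> exists N, forall m, (N <= m)%N -> P l m d.
  by exists d0 => // d d1 d2; apply: eventually_finite => l; apply: hd0.
elim: p H => [_|p IHp H]; first by exists 1 => // d _ _ [|l].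
have [|d1 d10 h1] := IHp.
  by move=> l /andP[l1 lp]; apply: H; rewrite l1 leqW.
have [|d2 d20 h2] := H p.+1; first by rewrite leqnn.
exists (Num.min d1 d2); first by rewrite lt_min d10.
move=> d d0; rewrite lt_min => /andP[dd1 dd2] l /andP[l1].
rewrite leq_eqVlt => /predU1P[->|lp]; first exact: h2.
by apply: h1; rewrite // l1.
Qed.

Unset Implicit Arguments.
Set Strict Implicit.

Theorem theorem4p4 (R : realType) (alpha : nat -> R[i]) (b : R) (p : nat)
    (c : int -> R[i])
    (alpha_disk : forall n, `|alpha n| < 1)
    (b_gt0 : 0 < b) (b_lt1 : b < 1) (p_ge1 : (1 <= p)%N)
    (c_periodic : forall j : int, c (j + p%:Z) = c j)
    (c_prod : \prod_(1 <= j < p.+1) c j%:Z = 1)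
    (alpha_ratio : forall l : nat, (1 <= l <= p)%N ->
       (alpha (m * p + l)%N / alpha (m * p + l).-1 : R[i]^o) @[m --> \oo]
         --> (b%:C%C * c l%:Z : R[i]^o)) :
  exists2 delta0 : R, 0 < delta0 &
  forall delta : R, 0 < delta -> delta < delta0 ->
  exists N : nat, forall m l : nat, (1 <= l <= p)%N -> (N <= m * p + l)%N ->
    let ws := [seq w <- zeros (W p b%:C%C c l%:Z) | `|w| < b%:C%C] in
    let zs := [seq z <- zeros (phi alpha (m * p + l)) |
                `|z| < (b - delta)%:C%C] in
    (forall z, z \in zs -> exists2 w, w \in ws & `|z - w| < delta%:C%C) /\
    (forall w, w \in ws ->
       count (fun z => `|z - w| < delta%:C%C) zs = count_mem w ws).
Proof.
pose concl l n (delta : R) :=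
    let ws := [seq w <- zeros (W p b%:C%C c l%:Z) | `|w| < b%:C%C] in
    let zs := [seq z <- zeros (phi alpha n) |
                `|z| < (b - delta)%:C%C] in
    (forall z, z \in zs -> exists2 w, w \in ws & `|z - w| < delta%:C%C) /\
    (forall w, w \in ws ->
       count (fun z => `|z - w| < delta%:C%C) zs = count_mem w ws).
suff [d0 d00 hd0] : exists2 d0 : R, 0 < d0 & forall d, 0 < d -> d < d0 ->
    exists N, forall l m, (1 <= l <= p)%N -> (N <= m)%N ->
    concl l (m * p + l)%N d.
  (* As [l <= p], the bound [N.+1 * p <= m * p + l] forces [N <= m]. *)
  exists d0 => // d /hd0 h /h[N hN]; exists (N.+1 * p)%N => m l lp Nm.
  apply: hN => //; case/andP: lp => l1 lp.
  rewrite -(leq_pmul2r p_ge1) -(leq_add2r p).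
  by rewrite mulSnr in Nm; rewrite (leq_trans Nm) // leq_add2l.
apply: (delta_finite (P := fun l m d => concl l (m * p + l)%N d)).
case=> // l lp.
set g := W p b%:C%C c l.+1%:Z.
have g0 : g != 0.
  apply/eqP => /polyP/(_ 0%N); rewrite coef0 coef_poly p_ge1 big_geq //.
  by apply/eqP; rewrite oner_eq0.
have [d0 d00 hd0] := hurwitz g0 b_gt0.
(* The bound by [b] keeps the radius [b - d] nonnegative. *)
exists (Num.min d0 b); first by rewrite lt_min d00.
move=> d d1; rewrite lt_min => /andP[/(hd0 d d1)[mu mu0 hmu] db].
have rb : 0 <= b - d < b by apply/andP; split; lra.
have [N hN] := Phi_approx alpha_disk b_gt0 b_lt1 p_ge1 c_periodic c_prod
  alpha_ratio rb mu0.
have [k k0 hk] := reversed_lower alpha_disk b_gt0 b_lt1 p_ge1 c_periodic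
  c_prod alpha_ratio.
have [N' hN'] := alpha_neq0 b_gt0 p_ge1 c_periodic c_prod alpha_ratio.
exists (maxn N N') => m; rewrite geq_max => /andP[Nm Nm'].
rewrite /concl addnS; set n := (m * p + l)%N.
have mn : (m <= n)%N by rewrite (leq_trans (leq_pmulr m p_ge1)) // leq_addr.
have Wg : W p b%:C%C c n.+1%:Z = g by rewrite -addnS W_periodic.
pose a := (\prod_(j < n.+1) sqrtC (1 - `|alpha j| ^+ 2))^-1.
have a0 : a != 0.
  rewrite invr_eq0; apply/prodf_neq0 => j _.
  rewrite sqrtC_eq0 subr_eq0 eq_sym -[X in _ == X](expr1n _ 2).
  by rewrite eqrXn2 // lt_eqF ?alpha_disk.
have rn0 z j : normc z <= 1 -> (reversed j (Phi alpha j)).[z] != 0.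
  by move=> /(hk j) h; rewrite -normc_gt0 (lt_le_trans k0).
(* The multipliers vanish nowhere in [|z| < b]: the zeros of [pole_factor] have modulus [b], and
   [Phi_n^*] is bounded below. The normalisation [a] of [phi] goes into [V] to scale both sides
   alike. *)
apply: (hmu _ (pole_factor b p)
  (a * - (alpha n)^* *: reversed n (Phi alpha n))).
- rewrite scale_poly_eq0 (negbTE a0) orFb; apply: contraNneq (rn0 0 n.+1 _).
    by move=> ->; rewrite reversed0 horner0.
  by rewrite normc0.
- move=> z zb; rewrite horner_pole_factor hornerZ !mulf_neq0 ?oppr_eq0 //.
  + split=> //; rewrite subr_eq0 eq_sym; apply: contraTneq zb => e.
    have bp0 : b%:C%C ^+ p != 0.
      by rewrite expf_neq0 // -normc_gt0 normc_real gtr0_norm.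
    have /(congr1 (@normc R)) : z ^+ p = b%:C%C ^+ p.
      by rewrite -[LHS](divfK bp0) e mul1r.
    rewrite !normcX normc_real gtr0_norm // => /(pexpIrn p_ge1) ->.
    - by rewrite ltxx.
    - by rewrite nnegrE normc_ge0.
    - by rewrite nnegrE ltW.
  + by rewrite conjC_eq0 hN' // (leq_trans Nm').
  + by rewrite rn0 // (le_trans (ltW zb)) // ltW.
move=> z zr muz; have := hN n z (leq_trans Nm mn) zr; rewrite Wg => /(_ muz).
have -> : pole_factor b p * phi alpha n.+1 =
    a *: (pole_factor b p * Phi alpha n.+1) by rewrite -scalerAr.
rewrite -scalerA -!scalerAl ![(a *: _).[z]]hornerZ -mulrBr !normcM.
by rewrite ltr_pM2l ?normc_gt0.
Qed.
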